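(* Let $(M,F)$ be a conic pseudo-Finsler surface with $F$ defined on the conic sub-bundle $\mathcal A$, let $\phi:\mathcal A\to\mathbb R$ be a smooth function positively homogeneous of degree $0$ in $y$ with $\sigma+\varepsilon-(\phi_{;2})^2\neq0$ on $\mathcal A$, where $\sigma=\phi_{;2;2}+\varepsilon\mathcal I\phi_{;2}+2(\phi_{;2})^2$; put $\rho=1/(\sigma+\varepsilon-(\phi_{;2})^2)$ and $\overline F=e^{\phi}F$. Then the frame and angular metric of $\overline F$ satisfy: (i) $\overline\ell_i=e^{\phi}[\ell_i+\phi_{;2}\,m_i]$ and $\overline\ell^{\,i}=e^{-\phi}\ell^i$; (ii) $\overline h_{ij}=e^{2\phi}[h_{ij}+(\sigma-(\phi_{;2})^2)m_im_j]$; (iii) $\overline m_i=e^{\phi}\sqrt{\varepsilon/\rho}\;m_i$ and $\overline m^{\,j}=e^{-\phi}\sqrt{\varepsilon\rho}\,[m^j-\varepsilon\phi_{;2}\,\ell^j]$; (iv) $\overline m_i\overline m^{\,i}=\varepsilon$, $\overline\ell_i\overline\ell^{\,i}=1$, $\overline\ell^{\,i}\overline m_i=\overline\ell_i\overline m^{\,i}=0$.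
   Context: Let $M$ be a smooth 2-dimensional manifold, $(x^1,x^2)$ local coordinates and $(x^i,y^i)$ the induced coordinates on $TM$; all formulas are in such a coordinate system and repeated indices are summed over $\{1,2\}$. Write $\dot\partial_i=\partial/\partial y^i$. A conic sub-bundle is a non-empty open subset $\mathcal A\subset TM\setminus 0$ projecting onto $M$ and closed under multiplication by positive scalars. A conic pseudo-Finsler metric on $M$ is a smooth function $F:\mathcal A\to\mathbb R$, positively homogeneous of degree $1$ in $y$, such that $g_{ij}=\tfrac12\dot\partial_i\dot\partial_jF^2$ is non-degenerate at each point of $\mathcal A$; $(g^{ij})$ is the inverse matrix. A conic pseudo-Finsler surface is equipped with its modified Berwald frame: $F$ is nowhere zero on $\mathcal A$, $\ell_i=\dot\partial_iF$, $\ell^i=g^{ij}\ell_j=y^i/F$, $\varepsilon=\pm1$ (the signature of $F$) is the sign of $\det(g_{ij})$, $m_1=-\sqrt{\varepsilon\det(g_{ij})}\,\ell^2$, $m_2=\sqrt{\varepsilon\det(g_{ij})}\,\ell^1$, $m^i=g^{ij}m_j$; thus $g_{ij}=\ell_i\ell_j+\varepsilon m_im_j$, $\ell^im_i=0$, $m^im_i=\varepsilon$. The angular metric is $h_{ij}=F\dot\partial_i\dot\partial_jF=\varepsilon m_im_j$. The main scalar $\mathcal I$ is defined by $F\,C_{ijk}=\mathcal I\,m_im_jm_k$, where $C_{ijk}=\tfrac12\dot\partial_kg_{ij}$. For a smooth function $f$ on $\mathcal A$, $f_{;2}:=\varepsilon F(\dot\partial_if)m^i$ and $f_{;2;2}:=(f_{;2})_{;2}$.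 Barred objects $\overline g_{ij},\overline g^{ij},\overline\ell_i,\overline\ell^{\,i},\overline m_i,\overline m^{\,i},\overline h_{ij}$ are given by the same formulas with $\overline F$ in place of $F$, the symbol $\varepsilon$ being kept unchanged (so $\overline h_{ij}=\overline F\dot\partial_i\dot\partial_j\overline F=\varepsilon\overline m_i\overline m_j$); $\overline F$ is a conic pseudo-Finsler metric because $\sigma+\varepsilon-(\phi_{;2})^2\ne0$.
   Formalization: The identity m̄_i m̄^i = ε is stated only where ερ > 0: σ+ε−(φ_{;2})² ≠ 0 alone allows ερ < 0 (Euclidean F, φ = ln cos 2θ, ρ = −1/3), where the real roots defining m̄ do not exist; the formal root is 0 there, and all other clauses keep the original hypotheses. *)

(* Defs.v *)
From HB Require Import structures.
From mathcomp Require Import all_boot all_order all_algebra.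
From mathcomp Require Import all_classical all_reals all_analysis.

Set Implicit Arguments.
Unset Strict Implicit.
Unset Printing Implicit Defensive.

Import Order.TTheory GRing.Theory Num.Theory.
Import numFieldNormedType.Exports.

Local Open Scope classical_set_scope.
Local Open Scope ring_scope.

Fixpoint iter_derive (R : realType) (V W : normedModType R) (vs : seq V)
    (f : V -> W) : V -> W :=
  if vs is v :: vs' then fun x => 'D_v (iter_derive vs' f) x else f.

(* C^oo on an open set U, for a function whose values outside U are junk: these
   values play no role, derivatives at points of U being local. *)
Definition smooth_on (R : realType) (V W : normedModType R) (U : set V)
    (f : V -> W) : Prop :=
  forall (vs : seq V) (x : V), U x -> differentiable (iter_derive vs f) x.

(* A smooth 2-manifold with an atlas. [param a] is the inverse of the chart
   [coord a] on its image; [coord a] and [param a] are junk outside [dom a] and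
   [coord a @` dom a] respectively. *)
Record smoothSurface (R : realType) := SmoothSurface {
  carrier :> topologicalType ;
  surface_hausdorff : hausdorff_space carrier ;
  surface_second_countable : @second_countable carrier ;
  chart : Type ;
  dom : chart -> set carrier ;
  coord : chart -> carrier -> 'rV[R]_2 ;
  param : chart -> 'rV[R]_2 -> carrier ;
  dom_cover : forall p, exists a, dom a p ;
  dom_open : forall a, open (dom a) ;
  coord_open : forall a, open (coord a @` dom a) ;
  coordK : forall a p, dom a p -> param a (coord a p) = p ;
  coord_continuous : forall a p, dom a p -> {for p, continuous (coord a)} ;
  param_continuous : forall a x, (coord a @` dom a) x ->
    {for x, continuous (param a)} ;
  transition_smooth : forall a b,
    smooth_on (coord a @` (dom a `&` dom b)) (coord b \o param a)
}.

Section TangentBundle.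
Variables (R : realType) (M : smoothSurface R).

Definition transition (a b : chart M) : 'rV[R]_2 -> 'rV[R]_2 :=
  coord b \o param a.

(* A tangent vector is given by its components in all charts around its base
   point, related by the Jacobians of the transition maps (the components in the
   other charts are set to 0 so that equality of vectors is equality of
   components). *)
Record tangent := Tangent {
  base : M ;
  comp : chart M -> 'rV[R]_2 ;
  comp_out : forall a, ~ dom a base -> comp a = 0 ;
  comp_change : forall a b, dom a base -> dom b base ->
    comp b = 'd (transition a b) (coord a base) (comp a)
}.

Lemma scale_comp_out (c : R) (t : tangent) (a : chart M) :
  ~ dom a (base t) -> c *: comp t a = 0.
Proof. by move=> /comp_out ->; rewrite scaler0. Qed.

Lemma scale_comp_change (c : R) (t : tangent) (a b : chart M) :
  dom a (base t) -> dom b (base t) ->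
  c *: comp t b = 'd (transition a b) (coord a (base t)) (c *: comp t a).
Proof. by move=> ha hb; rewrite linearZ -comp_change. Qed.

Definition tscale (c : R) (t : tangent) : tangent :=
  @Tangent (base t) (fun a => c *: comp t a)
    (@scale_comp_out c t) (@scale_comp_change c t).

(* The induced coordinates (x, y) on the tangent bundle. *)
Definition tcoord (a : chart M) (t : tangent) : 'rV[R]_2 * 'rV[R]_2 :=
  (coord a (base t), comp t a).

Definition tdom (a : chart M) : set tangent := [set t | dom a (base t)].

Definition local_set (a : chart M) (A : set tangent) :
  set ('rV[R]_2 * 'rV[R]_2) := tcoord a @` (A `&` tdom a).

Definition local_fun (a : chart M) (f : tangent -> R) :
    'rV[R]_2 * 'rV[R]_2 -> R :=
  fun z => xget 0 (f @` [set t | tdom a t /\ tcoord a t = z]).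

(* Openness in the topology of TM, for which the maps [tcoord a] are
   homeomorphisms onto open sets. *)
Definition topen (A : set tangent) : Prop := forall a, open (local_set a A).

Definition tsmooth (A : set tangent) (f : tangent -> R) : Prop :=
  forall a, smooth_on (local_set a A) (local_fun a f).

Definition pos_homogeneous (A : set tangent) (k : nat) (f : tangent -> R) :
    Prop :=
  forall (c : R) (t : tangent), A t -> 0 < c -> f (tscale c t) = c ^+ k * f t.

Record conic_subbundle (A : set tangent) : Prop := ConicSubbundle {
  conic_nonempty : A !=set0 ;
  conic_open : topen A ;
  conic_nonzero : forall t, A t -> exists a, comp t a != 0 ;
  conic_onto : base @` A = setT ;
  conic_scale : forall (c : R) t, A t -> 0 < c -> A (tscale c t)
}.

End TangentBundle.

Section LocalFormulas.
Variable R : realType.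
Local Notation TU := ('rV[R]_2 * 'rV[R]_2)%type.
Implicit Types (f u e : TU -> R) (i j k : 'I_2) (z : TU).

(* The vertical derivative with respect to y^i; the indices 1, 2 are the
   elements 0, 1 of 'I_2. *)
Definition dy i f : TU -> R := fun z => 'D_(0 : 'rV[R]_2, delta_mx 0 i) f z.

Definition gmx f z : 'M[R]_2 :=
  \matrix_(i, j) (2^-1 * dy i (dy j (fun w => f w ^+ 2)) z).

Definition raise f (v : 'I_2 -> R) i z : R :=
  \sum_j invmx (gmx f z) i j * v j.

Definition sgn_det f z : R := Num.sg (\det (gmx f z)).

Definition ell_low f i z : R := dy i f z.

Definition ell_up f i z : R := raise f (fun j => ell_low f j z) i z.

Definition hang f i j z : R := f z * dy i (dy j f) z.

Definition cartan f i j k z : R := 2^-1 * dy k (fun w => gmx f w i j) z.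

(* The sign e is a parameter of the frame, so that the barred frame can be
   formed with the sign of the unbarred metric. *)
Definition m_low e f i z : R :=
  let s := Num.sqrt (e z * \det (gmx f z)) in
  if i == 0 then - s * ell_up f 1 z else s * ell_up f 0 z.

Definition m_up e f i z : R := raise f (fun j => m_low e f j z) i z.

Definition main_scalar e f z : R :=
  xget 0 [set I | forall i j k,
    f z * cartan f i j k z = I * m_low e f i z * m_low e f j z * m_low e f k z].

Definition semi2 e f u : TU -> R :=
  fun z => e z * f z * \sum_i dy i u z * m_up e f i z.

Definition sigma e f u z : R :=
  semi2 e f (semi2 e f u) z + e z * main_scalar e f z * semi2 e f u z
  + 2 * semi2 e f u z ^+ 2.

Definition rho e f u z : R :=
  (sigma e f u z + e z - semi2 e f u z ^+ 2)^-1.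

End LocalFormulas.

Record conic_pseudo_finsler (R : realType) (M : smoothSurface R)
    (A : set (tangent M)) (F : tangent M -> R) : Prop := ConicPseudoFinsler {
  cpf_conic : conic_subbundle A ;
  cpf_smooth : tsmooth A F ;
  cpf_homogeneous : pos_homogeneous A 1 F ;
  cpf_nondegenerate : forall a z, local_set a A z ->
    \det (gmx (local_fun a F) z) != 0
}.

(* Main.v *)
Require Import Defs.
From mathcomp Require Import all_boot all_order all_algebra.
From mathcomp Require Import all_classical all_reals all_analysis.
From mathcomp Require Import ring.

(* In the coordinates (x, y) put n = (-y^2, y^1) and b = (-F_2, F_1). Euler's
   relations F_i y^i = F, F_ij y^i = F_ij y^j = 0 and y^k dg_ij/dy^k = 0 force,
   in dimension 2, F F_ij = K n_i n_j and dg_ij/dy^k = c n_i n_j n_k, without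
   the symmetry of second derivatives. Hence det g = K F^2 and, with
   s = sqrt(eps det g), m_i = (s/F) n_i, m^i = (s/det g) b^i and
   v_;2 = F (b . dv) / s for every v. As b . ds = eps I s^2 / F, the term in I
   cancels in sigma: sigma = (F/s)^2 phi_ij b^i b^j + 2 (phi_;2)^2. The Hessian
   of e^phi F computed by the product rule is then again of the form
   K' n_i n_j, so the same frame formulas apply to it. *)

Set Implicit Arguments.
Unset Strict Implicit.
Unset Printing Implicit Defensive.

Import Order.TTheory GRing.Theory Num.Theory.
Import numFieldNormedType.Exports.

Local Open Scope classical_set_scope.
Local Open Scope ring_scope.

(** Since phi_;2;2 differentiates m^i, hence s, third derivatives of F do enter, but only through
    the single scalar c. On one side 2 C_ijk = c n_i n_j n_k and m_i = (s/F) n_i give I = c F^4 / (2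
    s^3); on the other, a variation c n_k n_i n_j of g_ij varies det g by c n_k F^2, and b.n = F
    turns this into b.ds = eps c F^3 / (2 s). Both are multiples of c, which is why I drops out of
    sigma. Each vanishing contraction with y has its own source: Euler's relation for a derivative
    of F handles the outer index of differentiation, while differentiating an earlier Euler relation
    handles an inner one. For F one has K = eps s^2 / F^2. For e^phi F the same computation replaces
    eps by 1/rho and adds the factor e^(2 phi), which is where rho comes from. *)

Lemma forall_I2 (P : 'I_2 -> Prop) : P 0 -> P 1 -> forall i, P i.
Proof.
move=> P0 P1 [[|[|//]] h]; first by rewrite (_ : Ordinal h = 0) //; exact: val_inj.
by rewrite (_ : Ordinal h = 1) //; exact: val_inj.
Qed.

Lemma sum_I2 (R : nmodType) (F : 'I_2 -> R) : \sum_i F i = F 0 + F 1.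
Proof.
by rewrite !big_ord_recl big_ord0 addr0; congr (_ + F _); exact: val_inj.
Qed.

(** * Rules for derivatives along a fixed direction *)

Section DirectionalDerivative.
Variables (R : realType) (V : normedModType R).
Implicit Types (f g : V -> R) (x v : V).

Lemma is_derive_mul f g x v (df dg : R) : is_derive x v f df -> is_derive x v g dg ->
  is_derive x v (fun w => f w * g w) (f x * dg + g x * df).
Proof. by move=> hf hg; exact: is_deriveM. Qed.

Lemma is_derive_add f g x v (df dg : R) : is_derive x v f df -> is_derive x v g dg ->
  is_derive x v (fun w => f w + g w) (df + dg).
Proof. by move=> hf hg; exact: is_deriveD. Qed.

Lemma is_derive_sub f g x v (df dg : R) : is_derive x v f df -> is_derive x v g dg ->
  is_derive x v (fun w => f w - g w) (df - dg).
Proof. by move=> hf hg; exact: is_deriveB. Qed.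

Lemma is_derive_inv f x v df : f x != 0 -> is_derive x v f df ->
  is_derive x v (fun w => (f w)^-1) (- (f x) ^- 2 * df).
Proof.
move=> fx [d1 d2]; apply: DeriveDef; first exact: derivableV.
by rewrite -d2; exact: deriveV.
Qed.

(** Both difference quotients are the same function of the increment. This reduces composition with
    real functions such as exp and sqrt to the one-variable chain rule. *)
Lemma is_derive_line f x v (df : R) :
  is_derive x v f df <-> is_derive (0 : R) 1 (fun t => f (t *: v + x)) df.
Proof.
have E : 'D_1 (fun t : R => f (t *: v + x)) (0 : R) = 'D_v f x.
  rewrite /derive; set F := (X in lim (X @ _)); set G := (X in _ = lim (X @ _)).
  suff -> : F = G by [].
  apply/funext => t; rewrite /F /G /=.
  by rewrite addr0 scale0r add0r /GRing.scale /= mulr1.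
split=> -[d1 d2]; apply: DeriveDef.
- exact: (derivable1P f x v).1.
- exact: etrans E d2.
- exact: (derivable1P f x v).2.
- exact: etrans (esym E) d2.
Qed.

Lemma is_derive_comp_real (h : R -> R) f x v (dh df : R) :
  is_derive (f x) 1 h dh -> is_derive x v f df ->
  is_derive x v (fun w => h (f w)) (dh * df).
Proof.
move=> hh /is_derive_line hf; apply/is_derive_line.
have := @is_derive1_comp _ h (fun t => f (t *: v + x)) 0 dh df.
by rewrite /= scale0r add0r; apply.
Qed.

(** The sign varies with the point. Writing sg(f) f = |f| = sqrt(f^2) removes it: both nested square
    roots are taken at positive numbers where f is non-zero, so local constancy of the sign need not
    be argued. *)
Lemma is_derive_sqrt_abs f x v (df : R) : f x != 0 -> is_derive x v f df ->
  is_derive x v (fun w => Num.sqrt (Num.sg (f w) * f w))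
    (Num.sg (f x) * df / (2 * Num.sqrt (Num.sg (f x) * f x))).
Proof.
move=> fx hf.
have -> : (fun w => Num.sqrt (Num.sg (f w) * f w))
    = (fun w => Num.sqrt (Num.sqrt (f w * f w))).
  by apply/funext => w; rewrite -normrEsg -expr2 sqrtr_sqr.
have ff : 0 < f x * f x by rewrite -expr2 exprn_even_gt0.
have sff : 0 < Num.sqrt (f x * f x) by rewrite sqrtr_gt0.
have h1 := @is_derive_comp_real Num.sqrt (fun w => f w * f w) x v _ _
  (is_derive1_sqrt ff) (is_derive_mul hf hf).
have h2 := @is_derive_comp_real Num.sqrt (fun w => Num.sqrt (f w * f w)) x v _ _
  (is_derive1_sqrt sff) h1.
apply: is_derive_eq h2 _.
have -> : Num.sqrt (f x * f x) = `|f x| by rewrite -expr2 sqrtr_sqr.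
rewrite -normrEsg; have n0 : `|f x| != 0 by rewrite normr_eq0.
have q0 : Num.sqrt `|f x| != 0 by rewrite sqrtr_eq0 -ltNge normr_gt0.
have E (q t e d : R) : q != 0 -> t != 0 -> d = e * t ->
    (2 * q)^-1 * ((2 * t)^-1 * (d * df + d * df)) = e * df / (2 * q).
  by move=> q1 t1 ->; field; apply/andP; split.
exact: E q0 n0 (numEsg _).
Qed.

End DirectionalDerivative.

(** * Positive homogeneity in y and Euler's relation *)

Section Homogeneity.
Variable R : realType.
Local Notation TU := ('rV[R]_2 * 'rV[R]_2)%type.
Variable U : set TU.
Hypothesis Uopen : open U.
Implicit Types (f g h : TU -> R) (i j : 'I_2) (z w : TU) (c : R).

Definition yscale c z : TU := (z.1, c *: z.2).

Hypothesis Ucone : forall c z, 0 < c -> U z -> U (yscale c z).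

Lemma near_open z : U z -> \near z, U z.
Proof. by move=> Uz; apply: open_nbhs_nbhs; split. Qed.

(** [S] carries the line through x along v affinely to the line through [S x] along v', so the
    difference quotients agree. It serves the dilation [yscale c], with v' = c v, and the ray
    through a point, with v' = (0, y). *)
Lemma derive_comp_line (V : normedModType R) (S : V -> TU) g x v v' :
  (forall h : R, S (h *: v + x) = h *: v' + S x) ->
  'D_v (g \o S) x = 'D_v' g (S x).
Proof.
move=> hS; rewrite /derive.
set F := (X in lim (X @ _)); set G := (X in _ = lim (X @ _)).
suff -> : F = G by [].
by apply/funext => t; rewrite /F /G /= hS.
Qed.

Lemma derivable_comp_line (V : normedModType R) (S : V -> TU) g x v v' :
  (forall h : R, S (h *: v + x) = h *: v' + S x) ->
  derivable g (S x) v' -> derivable (g \o S) x v.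
Proof.
move=> hS; rewrite /derivable.
set F := (X in cvg (X @ _)); set G := (X in _ -> cvg (X @ _)).
suff -> : F = G by [].
by apply/funext => t; rewrite /F /G /= hS.
Qed.

Lemma is_derive_dy g z i : differentiable g z ->
  is_derive z (0 : 'rV[R]_2, delta_mx 0 i) g (dy i g z).
Proof. by move=> dg; apply: DeriveDef => //; exact: diff_derivable. Qed.

(* Positive homogeneity of degree [a - b] on U, without negative powers. *)
Definition homogeneous_on (a b : nat) g : Prop :=
  forall c z, 0 < c -> U z -> c ^+ b * g (yscale c z) = c ^+ a * g z.

(** Differentiating c^b g(x, c y) = c^a g(x, y) in y^i brings out one more factor c on the left,
    which is absorbed in b: the degree a - b falls by one. *)
Lemma homogeneous_on_dy a b g i : (forall z, U z -> differentiable g z) ->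
  homogeneous_on a b g -> homogeneous_on a b.+1 (dy i g).
Proof.
move=> dg hg c z c0 Uz; set e : TU := (0 : 'rV[R]_2, delta_mx 0 i).
have Dcomp : 'D_e (g \o yscale c) z = c * dy i g (yscale c z).
  rewrite (@derive_comp_line _ (yscale c) _ _ _ (c *: e)).
    rewrite deriveE; last exact/dg/Ucone.
    by rewrite linearZ /= -deriveE //; exact/dg/Ucone.
  move=> h; rewrite /yscale /e; congr pair => /=.
    by rewrite !scaler0.
  by rewrite scalerDr !scalerA mulrC.
have dcomp : derivable (g \o yscale c) z e.
  apply: (@derivable_comp_line _ (yscale c) _ _ _ (c *: e)); last first.
    exact/diff_derivable/dg/Ucone.
  move=> h; rewrite /yscale /e; congr pair => /=.
    by rewrite !scaler0.
  by rewrite scalerDr !scalerA mulrC.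
(* The homogeneity identity holds on a neighbourhood of z because U is open, so it may be
   differentiated. *)
have E : 'D_e (c ^+ b *: (g \o yscale c)) z = 'D_e (c ^+ a *: g) z.
  by apply: near_eq_derive; near=> w; apply: hg => //; near: w; exact: near_open.
move: E; rewrite (deriveZ _ dcomp) (deriveZ _ (diff_derivable (dg _ Uz))).
by rewrite Dcomp exprSr -mulrA.
Unshelve. all: by end_near. Qed.

Lemma deriveE_dy g z (y : 'rV[R]_2) : differentiable g z ->
  'D_(0 : 'rV[R]_2, y) g z = y 0 0 * dy 0 g z + y 0 1 * dy 1 g z.
Proof.
move=> dg; rewrite /dy !deriveE //.
have -> : (0 : 'rV[R]_2, y) = y 0 0 *: ((0 : 'rV[R]_2), delta_mx 0 (0 : 'I_2) : 'rV[R]_2)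
   + y 0 1 *: ((0 : 'rV[R]_2), delta_mx 0 (1 : 'I_2) : 'rV[R]_2).
  congr pair => /=; first by rewrite !scaler0 addr0.
  by rewrite [LHS]matrix_sum_delta big_ord1 sum_I2.
by rewrite linearD !linearZ.
Qed.

(** The derivative at c = 1 of c^b g(x, c y) = c^a g(x, y) reads b g + y.dg = a g. *)
Lemma euler a b g z : (forall z, U z -> differentiable g z) ->
  homogeneous_on a b g -> U z ->
  z.2 0 0 * dy 0 g z + z.2 0 1 * dy 1 g z = (a%:R - b%:R) * g z.
Proof.
move=> dg hg Uz; rewrite -deriveE_dy; last exact: dg.
(* The parameter is t = c - 1, so that the ray passes through z at t = 0; the factor t + 1 is
   positive only for t near 0, which suffices. *)
pose S (t : R) : TU := yscale (t + 1) z.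
have S0 : S 0 = z by rewrite /S /yscale add0r scale1r -surjective_pairing.
have hS (h : R) : S (h *: (1 : R) + 0) = h *: (0 : 'rV[R]_2, z.2) + S 0.
  rewrite /S /yscale; congr pair => /=; first by rewrite scaler0 add0r.
  by rewrite addr0 add0r scalerDl scale1r /GRing.scale /= mulr1.
have DS : is_derive (0 : R) 1 (g \o S) ('D_(0, z.2) g z).
  apply: DeriveDef.
    by apply: derivable_comp_line hS _; rewrite S0; exact/diff_derivable/dg.
  by rewrite (derive_comp_line _ hS) S0.
have Dadd1 : is_derive (0 : R) 1 (fun t : R => t + 1) 1.
  by apply: is_derive_eq; rewrite addr0.
have DX n : is_derive (0 : R) 1 (fun t : R => (t + 1) ^+ n) n%:R.
  elim: n => [|n IHn].
    by under eq_fun do rewrite expr0; exact: is_derive_cst.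
  under eq_fun do rewrite exprS.
  apply: is_derive_eq (is_derive_mul Dadd1 IHn) _.
  by rewrite add0r expr1n !mul1r natr1.
have [_ DL] := is_derive_mul (DX b) DS.
have [_ DR] := is_derive_mul (DX a) (is_derive_cst (g z) (0 : R) (1 : R)).
have E : \forall t \near (0 : R), (t + 1) ^+ b * (g \o S) t = (t + 1) ^+ a * g z.
  near=> t; apply: hg => //; rewrite -ltrBlDr add0r.
  by near: t; apply: lt_nbhsr; rewrite ltrN10.
have := near_eq_derive (1 : R) E; rewrite DL DR /= S0 add0r !expr1n mulr0 !mul1r add0r.
by move=> H; rewrite mulrBl [_ * g z]mulrC -H; ring.
Unshelve. all: by end_near. Qed.
End Homogeneity.

(** * Pointwise algebra of the frame in dimension 2 *)

Lemma det2 (R : comPzRingType) (A : 'M[R]_2) :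
  \det A = A 0 0 * A 1 1 - A 0 1 * A 1 0.
Proof.
rewrite (expand_det_row _ 0) sum_I2 /cofactor !det_mx11 !mxE /= expr0 expr1.
have -> : lift 0 0 = 1 :> 'I_2 by exact: val_inj.
have -> : lift 1 0 = 0 :> 'I_2 by exact: val_inj.
by rewrite mul1r mulN1r mulrN.
Qed.

Section FrameAlgebra.
Variable R : realType.
Local Notation TU := ('rV[R]_2 * 'rV[R]_2)%type.
Implicit Types (f : TU -> R) (i j k : 'I_2) (z : TU) (Q : 'I_2 -> 'I_2 -> R).

(* The covector orthogonal to y and the vector orthogonal to the covector dy f.
   By Euler's relation, (y, dvec) / f is dual to the coframe (dy f, ncov). *)
Definition ncov z i : R := if i == 0 then - z.2 0 1 else z.2 0 0.
Definition dvec f z i : R := if i == 0 then - dy 1 f z else dy 0 f z.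

Definition euler1 f z :=
  z.2 0 0 * dy 0 f z + z.2 0 1 * dy 1 f z = f z.

(** The resolution of the identity in the dual bases (y, b) / F and (dF, n); once F is replaced by
    y.dF it is a polynomial identity in each component. *)
Lemma frame_expand1 f z (v : 'I_2 -> R) i : euler1 f z ->
  f z * v i = dy i f z * (\sum_j z.2 0 j * v j)
            + ncov z i * (\sum_j dvec f z j * v j).
Proof.
move=> <-; move: i; apply: forall_I2; rewrite !sum_I2 /ncov /dvec /=;
  move: (z.2 0 0) (z.2 0 1) (dy 0 f z) (dy 1 f z) (v 0) (v 1) => *; ring.
Qed.

Lemma frame_expand2 f z Q i j : euler1 f z ->
  f z ^+ 2 * Q i j =
    dy i f z * dy j f z * (\sum_i' z.2 0 i' * \sum_j' z.2 0 j' * Q i' j')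
  + dy i f z * ncov z j * (\sum_j' dvec f z j' * \sum_i' z.2 0 i' * Q i' j')
  + ncov z i * dy j f z * (\sum_i' dvec f z i' * \sum_j' z.2 0 j' * Q i' j')
  + ncov z i * ncov z j * (\sum_i' dvec f z i' * \sum_j' dvec f z j' * Q i' j').
Proof.
move=> <-; move: j; apply: forall_I2; move: i; apply: forall_I2;
  rewrite !sum_I2 /ncov /dvec /=;
  move: (z.2 0 0) (z.2 0 1) (dy 0 f z) (dy 1 f z) (Q 0 0) (Q 0 1) (Q 1 0) (Q 1 1) => *;
  ring.
Qed.

Lemma frame_expand2_0 f z Q i j : euler1 f z ->
  (forall i, \sum_j z.2 0 j * Q i j = 0) ->
  (forall j, \sum_i z.2 0 i * Q i j = 0) ->
  f z ^+ 2 * Q i j = ncov z i * ncov z j *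
    (\sum_i' dvec f z i' * \sum_j' dvec f z j' * Q i' j').
Proof.
move=> hE h1 h2; rewrite frame_expand2 //.
have -> : \sum_i' z.2 0 i' * \sum_j' z.2 0 j' * Q i' j' = 0.
  by rewrite big1 // => k _; rewrite h1 mulr0.
have -> : \sum_j' dvec f z j' * \sum_i' z.2 0 i' * Q i' j' = 0.
  by rewrite big1 // => k _; rewrite h2 mulr0.
have -> : \sum_i' dvec f z i' * \sum_j' z.2 0 j' * Q i' j' = 0.
  by rewrite big1 // => k _; rewrite h1 mulr0.
by rewrite !mulr0 !add0r.
Qed.

(** For fixed k the two-index expansion gives F^2 G_kij = n_i n_j B_k with B_k = b^i b^j G_kij. The
    hypothesis on the first index gives y.B = 0, so B is in turn a multiple of n. *)
Lemma frame_expand3_0 f z (G : 'I_2 -> 'I_2 -> 'I_2 -> R) :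
  euler1 f z -> f z != 0 ->
  (forall i j, \sum_k z.2 0 k * G k i j = 0) ->
  (forall k i, \sum_j z.2 0 j * G k i j = 0) ->
  (forall k j, \sum_i z.2 0 i * G k i j = 0) ->
  exists c, forall k i j, G k i j = c * ncov z k * ncov z i * ncov z j.
Proof.
move=> hE f0 h0 h1 h2.
pose B k := \sum_i dvec f z i * \sum_j dvec f z j * G k i j.
have GE k i j : f z ^+ 2 * G k i j = ncov z i * ncov z j * B k.
  by apply: (@frame_expand2_0 f z (G k)) => //.
have yB : \sum_k z.2 0 k * B k = 0.
  have := h0 0 0; have := h0 0 1; have := h0 1 0; have := h0 1 1.
  rewrite /B !sum_I2 => h11 h10 h01 h00.
  transitivity (dvec f z 0 * dvec f z 0 * (z.2 0 0 * G 0 0 0 + z.2 0 1 * G 1 0 0)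
    + dvec f z 0 * dvec f z 1 * (z.2 0 0 * G 0 0 1 + z.2 0 1 * G 1 0 1)
    + dvec f z 1 * dvec f z 0 * (z.2 0 0 * G 0 1 0 + z.2 0 1 * G 1 1 0)
    + dvec f z 1 * dvec f z 1 * (z.2 0 0 * G 0 1 1 + z.2 0 1 * G 1 1 1)).
    move: (dvec f z 0) (dvec f z 1) (z.2 0 0) (z.2 0 1)
      (G 0 0 0) (G 0 0 1) (G 0 1 0) (G 0 1 1)
      (G 1 0 0) (G 1 0 1) (G 1 1 0) (G 1 1 1) => *; ring.
  by rewrite h11 h10 h01 h00 !mulr0 !addr0.
(* F^2 comes from expanding in i and j, one more F from expanding B. *)
exists ((\sum_k dvec f z k * B k) / f z ^+ 3) => k i j.
have := frame_expand1 B k hE; rewrite yB mulr0 add0r => Bk.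
apply: (mulfI (expf_neq0 3 f0)); rewrite exprS -mulrA GE mulrCA Bk.
move: (f z) f0 (ncov z i) (ncov z j) (ncov z k) (\sum_k _) => *; by field.
Qed.

Section Frame.
Variables (f : TU -> R) (z : TU) (K : R).
Hypothesis hE : euler1 f z.
Hypothesis f0 : f z != 0.
Hypothesis gE : forall i j,
  gmx f z i j = dy i f z * dy j f z + K * ncov z i * ncov z j.

(** The determinant of dF dF + K n n is K times the square of F_1 n_2 - F_2 n_1, which Euler's
    relation identifies with F. *)
Lemma det_gmx_frame : \det (gmx f z) = K * f z ^+ 2.
Proof. by rewrite det2 !gE /ncov /= -hE;
  move: (z.2 0 0) (z.2 0 1) (dy 0 f z) (dy 1 f z) => *; ring. Qed.

Hypothesis K0 : K != 0.

(** Indices are raised by checking a candidate against g rather than by computing the inverse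
    matrix; g is invertible since its determinant K F^2 is non-zero. *)
Lemma raise_unique (v w : 'I_2 -> R) i :
  (forall i, \sum_j gmx f z i j * w j = v i) -> raise f v i z = w i.
Proof.
move=> hw; have gU : gmx f z \in unitmx.
  by rewrite unitmxE det_gmx_frame unitfE mulf_neq0 // expf_neq0.
have E : (gmx f z) *m (\col_j w j) = \col_j v j.
  by apply/colP => j; rewrite !mxE -hw; apply: eq_bigr => k _; rewrite [X in _ * X]mxE.
have := congr1 (fun M => (invmx (gmx f z) *m M) i 0) E.
rewrite mulKmx // !mxE => ->; rewrite /raise; apply: eq_bigr => j _.
by rewrite mxE.
Qed.

Lemma ell_up_frame i : ell_up f i z = z.2 0 i / f z.
Proof.
apply: (@raise_unique _ (fun i => z.2 0 i / f z)) => {}i.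
rewrite sum_I2 !gE /ell_low -hE.
have := f0; rewrite -hE.
move: i; apply: forall_I2; rewrite /ncov /=;
  move: (z.2 0 0) (z.2 0 1) (dy 0 f z) (dy 1 f z) => *; by field.
Qed.

Lemma m_low_frame e i :
  m_low e f i z = Num.sqrt (e z * \det (gmx f z)) / f z * ncov z i.
Proof.
rewrite /m_low !ell_up_frame; move: i; apply: forall_I2; rewrite /ncov /=.
  by rewrite mulrN mulNr mulrA mulrAC.
by rewrite mulrA mulrAC.
Qed.

(** As b is annihilated by dF and n.b = F, lowering b gives K F n; dividing by det g = K F^2 leaves
    n / F. *)
Lemma m_up_frame e i : m_up e f i z =
  Num.sqrt (e z * \det (gmx f z)) / \det (gmx f z) * dvec f z i.
Proof.
apply: (@raise_unique _ (fun i => _ * dvec f z i)) => {}i.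
rewrite m_low_frame sum_I2 !gE; move: (Num.sqrt _) => s; rewrite det_gmx_frame.
have := f0; rewrite -hE; move: K0.
move: i; apply: forall_I2; rewrite /ncov /dvec /=;
  move: (z.2 0 0) (z.2 0 1) (dy 0 f z) (dy 1 f z) K => *; field; by apply/andP; split.
Qed.

Lemma frame_ell_pair : \sum_i ell_low f i z * ell_up f i z = 1.
Proof.
rewrite sum_I2 (ell_up_frame 0) (ell_up_frame 1).
have E (a b l m F : R) : F != 0 -> a * l + b * m = F ->
    l * (a / F) + m * (b / F) = 1.
  by move=> F0 h; rewrite mulrCA (mulrCA m) !mulrA -mulrDl h divff.
exact: E f0 hE.
Qed.

Lemma frame_ell_m e : \sum_i ell_up f i z * m_low e f i z = 0.
Proof.
rewrite sum_I2 (ell_up_frame 0) (ell_up_frame 1) (m_low_frame e 0) (m_low_frame e 1).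
rewrite /ncov /=.
have E (a b s F : R) : a / F * (s * - b) + b / F * (s * a) = 0 by ring.
exact: E.
Qed.

Lemma frame_m_ell e : \sum_i ell_low f i z * m_up e f i z = 0.
Proof.
rewrite sum_I2 (m_up_frame e 0) (m_up_frame e 1) /dvec /=.
have E (a b s : R) : a * (s * - b) + b * (s * a) = 0 by ring.
exact: E.
Qed.

(** The pairing equals (s^2 / det g) (n.b / F). The sign condition is what makes s^2 equal to e det
    g. *)
Lemma frame_m_pair e : 0 <= e z * \det (gmx f z) ->
  \sum_i m_low e f i z * m_up e f i z = e z.
Proof.
move=> ed; rewrite sum_I2 (m_low_frame e 0) (m_low_frame e 1).
rewrite (m_up_frame e 0) (m_up_frame e 1) /ncov /dvec /=.
have D0 : \det (gmx f z) != 0 by rewrite det_gmx_frame mulf_neq0 // expf_neq0.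
have E (a b l m F s D c : R) : F != 0 -> D != 0 -> s ^+ 2 = c * D ->
    a * l + b * m = F ->
    s / F * - b * (s / D * - m) + s / F * a * (s / D * l) = c.
  move=> F0 {}D0 h h1; transitivity (s ^+ 2 / D * ((a * l + b * m) / F)).
    by ring.
  by rewrite h h1 divff // mulr1 mulfK.
exact: E f0 D0 (sqr_sqrtr ed) hE.
Qed.

End Frame.
End FrameAlgebra.

Section Contractions.
Variable R : comPzRingType.

(** The contraction of dg_ij/dy^k with y^k: p, q and t stand for F_kj, F_ki and F_kij as vectors in
    k, and h for F_ij. *)
Lemma contract_first (y0 y1 F l0 l1 p0 p1 q0 q1 t0 t1 li lj h : R) :
  y0 * l0 + y1 * l1 = F -> y0 * p0 + y1 * p1 = 0 -> y0 * q0 + y1 * q1 = 0 ->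
  y0 * t0 + y1 * t1 = - h ->
  y0 * (li * p0 + lj * q0 + (F * t0 + h * l0))
  + y1 * (li * p1 + lj * q1 + (F * t1 + h * l1)) = 0.
Proof.
move=> h1 h2 h3 h4.
transitivity (li * (y0 * p0 + y1 * p1) + lj * (y0 * q0 + y1 * q1)
  + F * (y0 * t0 + y1 * t1) + h * (y0 * l0 + y1 * l1)); first by ring.
by rewrite h1 h2 h3 h4; ring.
Qed.

(** The contraction of dg_ij/dy^k with y^j: p, q and t stand for F_kj, F_ij and F_kij as vectors in
    j, and h for F_ki. *)
Lemma contract_last (y0 y1 F l0 l1 p0 p1 q0 q1 t0 t1 li lk h : R) :
  y0 * l0 + y1 * l1 = F -> y0 * p0 + y1 * p1 = 0 -> y0 * q0 + y1 * q1 = 0 ->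
  h + (y0 * t0 + y1 * t1) = 0 ->
  y0 * (li * p0 + l0 * h + (F * t0 + q0 * lk))
  + y1 * (li * p1 + l1 * h + (F * t1 + q1 * lk)) = 0.
Proof.
move=> h1 h2 h3 h4.
transitivity (li * (y0 * p0 + y1 * p1) + lk * (y0 * q0 + y1 * q1)
  + F * (h + (y0 * t0 + y1 * t1)) + h * (y0 * l0 + y1 * l1 - F)); first by ring.
by rewrite h1 h2 h3 h4; ring.
Qed.

End Contractions.

(** * Differentiation on a conic open set of coordinates (x, y) *)

Section LocalSurface.
Variable R : realType.
Local Notation TU := ('rV[R]_2 * 'rV[R]_2)%type.
Variable U : set TU.
Hypothesis Uopen : open U.
Hypothesis Ucone : forall (c : R) z, 0 < c -> U z -> U (yscale c z).
Implicit Types (f g h : TU -> R) (i j k : 'I_2) (z w : TU).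
Local Notation e_ i := ((0 : 'rV[R]_2), (delta_mx 0 i : 'rV[R]_2)).

Lemma smooth_on_dy0 g z : smooth_on U g -> U z -> differentiable g z.
Proof. by move=> sg; exact: (sg [::]). Qed.

Lemma smooth_on_dy1 g i z : smooth_on U g -> U z -> differentiable (dy i g) z.
Proof. by move=> sg; exact: (sg [:: e_ i]). Qed.

Lemma smooth_on_dy2 g i j z :
  smooth_on U g -> U z -> differentiable (dy i (dy j g)) z.
Proof. by move=> sg; exact: (sg [:: e_ i; e_ j]). Qed.

Lemma dy_near g h i z : U z -> (forall w, U w -> g w = h w) ->
  dy i g z = dy i h z.
Proof.
move=> Uz gh; apply: near_eq_derive.
by near=> w; apply: gh; near: w; exact: near_open.
Unshelve. all: by end_near. Qed.

Lemma is_derive_near g h z v (d : R) : U z -> (forall w, U w -> g w = h w) ->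
  is_derive z v h d -> is_derive z v g d.
Proof.
move=> Uz gh; apply: near_eq_is_derive.
by near=> w; apply/esym/gh; near: w; exact: near_open.
Unshelve. all: by end_near. Qed.

Lemma is_derive_coord i j z :
  is_derive z (e_ i) (fun w : TU => w.2 0 j) (i == j)%:R.
Proof.
apply/is_derive_line.
have -> : (fun t : R => (t *: e_ i + z).2 0 j)
    = (fun t : R => t * (i == j)%:R + z.2 0 j).
  by apply/funext => t; rewrite /= !mxE eqxx eq_sym.
apply: is_derive_eq (is_derive_add (is_derive_mul (is_derive_id (0 : R) (1 : R))
   (is_derive_cst ((i == j)%:R : R) (0 : R) (1 : R)))
   (is_derive_cst (z.2 0 j) (0 : R) (1 : R))) _.
by rewrite mulr0 addr0 mulr1 add0r.
Qed.

Lemma dy_val g i z (d : R) : is_derive z (e_ i) g d -> dy i g z = d.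
Proof. by case. Qed.

Lemma dy_cst (c : R) i z : dy i (fun=> c) z = 0.
Proof. exact: derive_cst. Qed.

(** The product rule with dy^j/dy^i = delta_ij. It differentiates a contraction identity and so
    yields contractions in the inner index of an iterated derivative. *)
Lemma dy_contract (g : 'I_2 -> TU -> R) h i z : U z ->
  (forall j, differentiable (g j) z) ->
  (forall w, U w -> \sum_j w.2 0 j * g j w = h w) ->
  dy i h z = g i z + \sum_j z.2 0 j * dy i (g j) z.
Proof.
move=> Uz dg gh.
have D j : is_derive z (e_ i) (fun w : TU => w.2 0 j * g j w)
    (z.2 0 j * dy i (g j) z + g j z * (i == j)%:R).
  exact: is_derive_mul (is_derive_coord _ _ _) (is_derive_dy _ _).
have [_ <-] : is_derive z (e_ i) h (g i z + \sum_j z.2 0 j * dy i (g j) z).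
  apply: (is_derive_near (h := fun w : TU => w.2 0 0 * g 0 w + w.2 0 1 * g 1 w)) => //.
    by move=> w Uw; rewrite -gh // sum_I2.
  apply: is_derive_eq (is_derive_add (D 0) (D 1)) _.
  rewrite sum_I2; move: i {D}; apply: forall_I2 => /=; rewrite mulr0 mulr1 addr0.
    by rewrite addrAC addrC.
  by rewrite addrA addrC.
by [].
Qed.

(** The derivatives are passed as arbitrary expressions G and H, so that one product rule serves
    both F and e^phi F. *)
Lemma gmx_of_derive g (G : 'I_2 -> TU -> R) (H : 'I_2 -> 'I_2 -> R) i j z :
  U z ->
  (forall w k, U w -> is_derive w (e_ k) g (G k w)) ->
  is_derive z (e_ i) (G j) (H i j) ->
  gmx g z i j = G i z * G j z + g z * H i j.
Proof.
move=> Uz dg dG; rewrite mxE.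
have -> : dy i (dy j (fun w => g w ^+ 2)) z = dy i (fun w => 2 * (g w * G j w)) z.
  apply: dy_near => // w Uw; rewrite /dy.
  under eq_fun do rewrite expr2.
  have [_ ->] := is_derive_mul (dg w j Uw) (dg w j Uw).
  by ring.
have [_ E] := is_derive_mul (is_derive_cst (2 : R) z (e_ i))
  (is_derive_mul (dg z i Uz) dG).
rewrite /dy E /=; move: (G i z) (G j z) (g z) (H i j) => *; by field.
Qed.

(** * Hessian, Cartan tensor, area density and main scalar of F *)

Section Metric.
Variable f : TU -> R.
Hypothesis fsmooth : smooth_on U f.
Hypothesis fhom : homogeneous_on U 1 0 f.
Hypothesis f0 : forall z, U z -> f z != 0.
Hypothesis fdet : forall z, U z -> \det (gmx f z) != 0.

Lemma metric_euler1 z : U z -> euler1 f z.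
Proof.
move=> Uz; rewrite /euler1 (euler _ fhom) // ?subr0 ?mul1r //.
by move=> w; exact: smooth_on_dy0.
Qed.

Lemma metric_euler_sum z : U z -> \sum_j z.2 0 j * dy j f z = f z.
Proof. by move=> Uz; rewrite sum_I2; exact: metric_euler1. Qed.

Lemma hess_contract_r i z : U z -> \sum_j z.2 0 j * dy i (dy j f) z = 0.
Proof.
move=> Uz; have /eqP := dy_contract i Uz (fun j => smooth_on_dy1 j fsmooth Uz)
  metric_euler_sum.
by rewrite -subr_eq0 opprD addrA subrr sub0r oppr_eq0 => /eqP.
Qed.

Lemma hess_contract_l j z : U z -> \sum_i z.2 0 i * dy i (dy j f) z = 0.
Proof.
move=> Uz; rewrite sum_I2 (@euler _ U 1 1) ?subrr ?mul0r //.
  by move=> w; exact: smooth_on_dy1.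
by apply: homogeneous_on_dy => // w; exact: smooth_on_dy0.
Qed.

Lemma hess_form z : U z ->
  {K | forall i j, f z * dy i (dy j f) z = K * ncov z i * ncov z j}.
Proof.
move=> Uz; exists ((\sum_i' dvec f z i' * \sum_j' dvec f z j' * dy i' (dy j' f) z) / f z).
move=> i j; have := frame_expand2_0 i j (metric_euler1 Uz)
  (fun i => hess_contract_r i Uz) (fun j => hess_contract_l j Uz).
move: (\sum_i' _) (f0 Uz) => B fz E; apply: (mulfI fz).
by rewrite mulrA -expr2 E; field.
Qed.

(** Symmetry is read off the form K n_i n_j. *)
Lemma hess_sym i j z : U z -> dy i (dy j f) z = dy j (dy i f) z.
Proof.
move=> Uz; have [K hK] := hess_form Uz; apply: (mulfI (f0 Uz)).
exact: etrans (hK i j) (etrans (mulrAC _ _ _) (esym (hK j i))).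
Qed.

Lemma gmxE i j z : U z ->
  gmx f z i j = dy i f z * dy j f z + f z * dy i (dy j f) z.
Proof.
move=> Uz; apply: (@gmx_of_derive f (fun k => dy k f) (fun i j => dy i (dy j f) z)) => //.
  by move=> w k Uw; apply/is_derive_dy/smooth_on_dy0.
exact/is_derive_dy/smooth_on_dy1.
Qed.

Lemma gmx_form z : U z -> {K | [/\ K != 0,
  forall i j, f z * dy i (dy j f) z = K * ncov z i * ncov z j &
  forall i j, gmx f z i j = dy i f z * dy j f z + K * ncov z i * ncov z j]}.
Proof.
move=> Uz; have [K hK] := hess_form Uz; exists K.
have gE i j : gmx f z i j = dy i f z * dy j f z + K * ncov z i * ncov z j.
  by rewrite gmxE //; congr (_ + _); exact: hK.
split=> //; apply: contraNneq (fdet Uz) => K0.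
by rewrite (det_gmx_frame (metric_euler1 Uz) gE) K0 mul0r.
Qed.

Lemma is_derive_gmx k i j z : U z ->
  is_derive z (e_ k) (fun w => gmx f w i j)
    ((dy i f z * dy k (dy j f) z + dy j f z * dy k (dy i f) z)
    + (f z * dy k (dy i (dy j f)) z + dy i (dy j f) z * dy k f z)).
Proof.
move=> Uz; apply: (is_derive_near (h := fun w =>
   dy i f w * dy j f w + f w * dy i (dy j f) w)) => //.
  by move=> w Uw; exact: gmxE.
apply: is_derive_add; apply: is_derive_mul; apply: is_derive_dy;
  by [exact: smooth_on_dy0 | exact: smooth_on_dy1 | exact: smooth_on_dy2].
Qed.

(** Twice the Cartan tensor, with the index of differentiation first. *)
Definition dgmx z k i j : R := dy k (fun w => gmx f w i j) z.

Lemma dgmxE k i j z : U z -> dgmx z k i j =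
    dy i f z * dy k (dy j f) z + dy j f z * dy k (dy i f) z
    + (f z * dy k (dy i (dy j f)) z + dy i (dy j f) z * dy k f z).
Proof. by move=> Uz; apply: dy_val; exact: is_derive_gmx. Qed.

Lemma dgmx_form z : U z ->
  exists c, forall k i j, dgmx z k i j = c * ncov z k * ncov z i * ncov z j.
Proof.
move=> Uz.
have G0 i j : \sum_k z.2 0 k * dgmx z k i j = 0.
  (* F_ij has degree -1, encoded as 1 - 2. *)
  have e2 := @euler _ U 1 2 (dy i (dy j f)) z
    (fun w => @smooth_on_dy2 f i j w fsmooth).
  rewrite sum_I2 !dgmxE //.
  have := metric_euler1 Uz; rewrite /euler1 => h1.
  have := hess_contract_l j Uz; rewrite sum_I2 => h2.
  have := hess_contract_l i Uz; rewrite sum_I2 => h3.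
  have {e2} h4 : z.2 0 0 * dy 0 (dy i (dy j f)) z
     + z.2 0 1 * dy 1 (dy i (dy j f)) z = - dy i (dy j f) z.
    apply: etrans (e2 _ Uz) _; last by move: (dy i _ z) => *; ring.
    apply: homogeneous_on_dy => //; first by move=> w; exact: smooth_on_dy1.
    by apply: homogeneous_on_dy => // w; exact: smooth_on_dy0.
  exact: contract_first h1 h2 h3 h4.
have Gr k i : \sum_j z.2 0 j * dgmx z k i j = 0.
  have /esym := dy_contract k Uz (fun j => @smooth_on_dy2 f i j z fsmooth Uz)
    (fun w => hess_contract_r i (z := w)).
  rewrite dy_cst !sum_I2 !dgmxE // => h4.
  have := metric_euler1 Uz; rewrite /euler1 => h1.
  have := hess_contract_r k Uz; rewrite sum_I2 => h2.
  have := hess_contract_r i Uz; rewrite sum_I2 => h3.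
  (* Differentiating F_ij y^j = 0 in y^k produces F_ik, whereas dg_ij/dy^k contains F_ki. *)
  rewrite (hess_sym _ _ Uz) in h4.
  exact: contract_last h1 h2 h3 h4.
have Gsym k i j : dgmx z k i j = dgmx z k j i.
  apply: dy_near => // w Uw; rewrite (gmxE i j Uw) (gmxE j i Uw) (hess_sym i j Uw).
  have E (a b c : R) : a * b + c = b * a + c by rewrite [a * b]mulrC.
  exact: E.
apply: (frame_expand3_0 (metric_euler1 Uz) (f0 Uz) G0 Gr) => k j.
rewrite -[RHS](Gr k j); apply: eq_bigr => i _; congr (_ * _); exact: Gsym.
Qed.

Lemma is_derive_dgmx k i j z : U z ->
  is_derive z (e_ k) (fun w => gmx f w i j) (dgmx z k i j).
Proof. by move=> Uz; rewrite dgmxE //; exact: is_derive_gmx. Qed.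

(** A variation c n_k n_i n_j of g_ij amounts to moving K by c n_k in det g = K F^2 with F held
    fixed. *)
Lemma det_variation (y0 y1 l0 l1 F K c nk : R) : y0 * l0 + y1 * l1 = F ->
  ((l0 * l0 + K * (- y1) * (- y1)) * (c * nk * y0 * y0)
    + (l1 * l1 + K * y0 * y0) * (c * nk * (- y1) * (- y1)))
  - ((l0 * l1 + K * (- y1) * y0) * (c * nk * y0 * (- y1))
    + (l1 * l0 + K * y0 * (- y1)) * (c * nk * (- y1) * y0))
  = c * nk * F ^+ 2.
Proof. by move=> <-; ring. Qed.

Lemma is_derive_det z c k : U z ->
  (forall k i j, dgmx z k i j = c * ncov z k * ncov z i * ncov z j) ->
  is_derive z (e_ k) (fun w => \det (gmx f w)) (c * ncov z k * f z ^+ 2).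
Proof.
move=> Uz hc; have [K [_ _ gE]] := gmx_form Uz.
have -> : (fun w => \det (gmx f w)) =
    (fun w => gmx f w 0 0 * gmx f w 1 1 - gmx f w 0 1 * gmx f w 1 0).
  by apply/funext => w; exact: det2.
apply: is_derive_eq (is_derive_sub
  (is_derive_mul (is_derive_dgmx k 0 0 Uz) (is_derive_dgmx k 1 1 Uz))
  (is_derive_mul (is_derive_dgmx k 0 1 Uz) (is_derive_dgmx k 1 0 Uz))) _.
rewrite (hc k 0 0) (hc k 0 1) (hc k 1 0) (hc k 1 1).
rewrite (gE 0 0) (gE 0 1) (gE 1 0) (gE 1 1).
exact: det_variation (metric_euler1 Uz).
Qed.

(** The s of the overview, that is, the area density sqrt |det g|. *)
Definition vol w : R := Num.sqrt (sgn_det f w * \det (gmx f w)).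

Lemma sgn_det_neq0 z : U z -> sgn_det f z != 0.
Proof. by move=> Uz; rewrite sgr_eq0 fdet. Qed.

Lemma sgn_det_sqr z : U z -> sgn_det f z ^+ 2 = 1.
Proof. by move=> Uz; rewrite sqr_sg fdet. Qed.

Lemma sgn_det_mul z : sgn_det f z * \det (gmx f z) = `|\det (gmx f z)|.
Proof. by rewrite -normrEsg. Qed.

Lemma vol_gt0 z : U z -> 0 < vol z.
Proof. by move=> Uz; rewrite sqrtr_gt0 sgn_det_mul normr_gt0 fdet. Qed.

Lemma vol_sqr z : vol z ^+ 2 = sgn_det f z * \det (gmx f z).
Proof. by rewrite sqr_sqrtr // sgn_det_mul. Qed.

Lemma det_vol z : U z -> \det (gmx f z) = sgn_det f z * vol z ^+ 2.
Proof. by move=> Uz; rewrite vol_sqr mulrA -expr2 sgn_det_sqr // mul1r. Qed.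

Lemma is_derive_vol z c k : U z ->
  (forall k i j, dgmx z k i j = c * ncov z k * ncov z i * ncov z j) ->
  is_derive z (e_ k) vol
    (sgn_det f z * (c * ncov z k * f z ^+ 2) / (2 * vol z)).
Proof.
move=> Uz hc.
exact: (is_derive_sqrt_abs (f := fun w => \det (gmx f w)) (fdet Uz)
  (is_derive_det k Uz hc)).
Qed.

(** The factor eps cancels against det g = eps s^2 in m^i = (s / det g) b^i. *)
Lemma semi2E v z : U z -> semi2 (sgn_det f) f v z =
  f z * (dy 0 f z * dy 1 v z - dy 1 f z * dy 0 v z) / vol z.
Proof.
move=> Uz; have [K [K0 _ gE]] := gmx_form Uz.
have mE i := m_up_frame (metric_euler1 Uz) (f0 Uz) gE K0 (sgn_det f) i.
rewrite /semi2 sum_I2 (mE 0) (mE 1) -/(vol z) (det_vol Uz) /dvec /=.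
have := sgn_det_neq0 Uz; have := lt0r_neq0 (vol_gt0 Uz).
have E (e s F u0 u1 l0 l1 : R) : s != 0 -> e != 0 ->
  e * F * (u0 * (s / (e * s ^+ 2) * (- l1)) + u1 * (s / (e * s ^+ 2) * l0))
   = F * (l0 * u1 - l1 * u0) / s.
  by move=> s0 e0; field; apply/andP; split.
exact: E.
Qed.

Lemma m_lowE i z : U z -> m_low (sgn_det f) f i z = vol z / f z * ncov z i.
Proof.
move=> Uz; have [K [K0 _ gE]] := gmx_form Uz.
exact: (m_low_frame (metric_euler1 Uz) (f0 Uz) gE K0).
Qed.

Lemma ncov_neq0 z : U z -> exists k, ncov z k != 0.
Proof.
move=> Uz; have [n0|] := eqVneq (ncov z 0) 0; last by exists 0.
have [n1|] := eqVneq (ncov z 1) 0; last by exists 1.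
have E (a b l m F : R) : a * l + b * m = F -> - b = 0 -> a = 0 -> F = 0.
  by move=> <- /eqP; rewrite oppr_eq0 => /eqP -> ->; rewrite !mul0r addr0.
by have := f0 Uz; rewrite (E _ _ _ _ _ (metric_euler1 Uz) n0 n1) eqxx.
Qed.

(** The choice made by [xget] is determined because the set is a singleton: the value c F^4 / (2
    s^3) satisfies all the equations, and one equation alone forces it. *)
Lemma main_scalarE z c : U z ->
  (forall k i j, dgmx z k i j = c * ncov z k * ncov z i * ncov z j) ->
  main_scalar (sgn_det f) f z = c * f z ^+ 4 / (2 * vol z ^+ 3).
Proof.
move=> Uz hc; have fz := f0 Uz; have s0 := lt0r_neq0 (vol_gt0 Uz).
have cE i j k : cartan f i j k z = 2^-1 * (c * ncov z k * ncov z i * ncov z j).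
  by rewrite -hc.
rewrite /main_scalar; set P := [set _ | _].
have PE I : P I <-> I = c * f z ^+ 4 / (2 * vol z ^+ 3).
  split=> [hI|-> i j k].
    (* Some n_k is non-zero since y = 0 would give F = 0; the equation with all three indices equal
       to k can then be divided by m_k^3. *)
    have [k nk] := ncov_neq0 Uz; have := hI k k k.
    rewrite cE !m_lowE //; move: (ncov z k) nk (f z) (vol z) fz s0 => n n0 F s F0 s0 h.
    have nz : (s / F * n) ^+ 3 != 0.
      by rewrite expf_neq0 // mulf_neq0 // mulf_neq0 // invr_eq0.
    apply: (mulIf nz); transitivity (F * (2^-1 * (c * n * n * n))).
      by rewrite h; ring.
    by field; apply/andP; split.
  rewrite cE !m_lowE //.
  move: (ncov z k) (ncov z i) (ncov z j) (f z) (vol z) fz s0 => n1 n2 n3 F s F0 s0.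
  by field; apply/andP; split.
case: xgetP => [I _ /PE //|].
by move=> /(_ _ ((PE _).2 erefl)).
Qed.

(** * Derivatives of the degree-0 function phi in the frame, up to sigma *)

Section Conformal.
Variable u : TU -> R.
Hypothesis usmooth : smooth_on U u.
Hypothesis uhom : homogeneous_on U 0 0 u.

Lemma factor_euler z : U z -> \sum_j z.2 0 j * dy j u z = 0.
Proof.
move=> Uz; rewrite sum_I2 (euler _ uhom) ?subrr ?mul0r //.
by move=> w; exact: smooth_on_dy0.
Qed.

Lemma factor_hess_r i z : U z -> \sum_j z.2 0 j * dy i (dy j u) z = - dy i u z.
Proof.
move=> Uz; have /eqP := dy_contract i Uz (fun j => smooth_on_dy1 j usmooth Uz)
  factor_euler.
by rewrite dy_cst eq_sym addrC addr_eq0 => /eqP.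
Qed.

Lemma factor_hess_l j z : U z -> \sum_i z.2 0 i * dy i (dy j u) z = - dy j u z.
Proof.
move=> Uz; rewrite sum_I2; apply: etrans (@euler _ U 0 1 _ _ _ _ Uz) _.
- by move=> w; exact: smooth_on_dy1.
- by apply: homogeneous_on_dy => // w; exact: smooth_on_dy0.
- by rewrite sub0r mulN1r.
Qed.

(** The fibre Jacobian of (F, phi), equal to b.dphi; phi_;2 is F/s times it. *)
Definition wron z : R := dy 0 f z * dy 1 u z - dy 1 f z * dy 0 u z.

Lemma dvec_factor z : \sum_j dvec f z j * dy j u z = wron z.
Proof. by rewrite sum_I2 /dvec /= mulNr addrC. Qed.

Lemma factor_dyE i z : U z -> dy i u z = wron z * ncov z i / f z.
Proof.
move=> Uz; have := frame_expand1 (fun i => dy i u z) i (metric_euler1 Uz).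
rewrite factor_euler // dvec_factor mulr0 add0r mulrC [ncov z i * _]mulrC => <-.
by rewrite mulfK // f0.
Qed.

Definition bhess z : R :=
  \sum_i dvec f z i * \sum_j dvec f z j * dy i (dy j u) z.

(** Unlike F_ij, the Hessian of phi does not annihilate y: each phi_j has degree -1, so its
    contraction with y is -dphi. The yy part vanishes by y.dphi = 0, but the mixed parts -b.dphi
    survive. *)
Lemma factor_hessE i j z : U z -> dy i (dy j u) z =
  (bhess z * ncov z i * ncov z j
   - wron z * (dy i f z * ncov z j + ncov z i * dy j f z)) / f z ^+ 2.
Proof.
move=> Uz.
have hyy : \sum_i z.2 0 i * (\sum_j z.2 0 j * dy i (dy j u) z) = 0.
  under eq_bigr do rewrite factor_hess_r // mulrN.
  by rewrite sumrN factor_euler // oppr0.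
have hby : \sum_i dvec f z i * (\sum_j z.2 0 j * dy i (dy j u) z) = - wron z.
  under eq_bigr do rewrite factor_hess_r // mulrN.
  by rewrite sumrN dvec_factor.
have hyb : \sum_j dvec f z j * (\sum_i z.2 0 i * dy i (dy j u) z) = - wron z.
  under eq_bigr do rewrite factor_hess_l // mulrN.
  by rewrite sumrN dvec_factor.
have E (F q li lj ni nj W B a b c : R) : F != 0 ->
  a = 0 -> b = - W -> c = - W ->
  F ^+ 2 * q = li * lj * a + li * nj * b + ni * lj * c + ni * nj * B ->
  q = (B * ni * nj - W * (li * nj + ni * lj)) / F ^+ 2.
  move=> F0 -> -> -> h; apply: (mulfI (expf_neq0 2 F0)); rewrite h; by field.
exact: E (f0 Uz) hyy hyb hby
  (frame_expand2 (fun i j => dy i (dy j u) z) i j (metric_euler1 Uz)).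
Qed.

Lemma phi2E z : U z -> semi2 (sgn_det f) f u z = f z * wron z / vol z.
Proof. exact: semi2E. Qed.

Lemma is_derive_semi2 z c k : U z ->
  (forall k i j, dgmx z k i j = c * ncov z k * ncov z i * ncov z j) ->
  is_derive z (e_ k) (semi2 (sgn_det f) f u)
   (f z * wron z * (- vol z ^- 2 *
      (sgn_det f z * (c * ncov z k * f z ^+ 2) / (2 * vol z)))
   + (vol z)^-1 * (f z * (dy 0 f z * dy k (dy 1 u) z + dy 1 u z * dy k (dy 0 f) z
        - (dy 1 f z * dy k (dy 0 u) z + dy 0 u z * dy k (dy 1 f) z))
      + wron z * dy k f z)).
Proof.
move=> Uz hc.
apply: (is_derive_near (h := fun w => f w * wron w * (vol w)^-1)) => //.
  by move=> w Uw; exact: phi2E.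
have d0 i : is_derive z (e_ k) (dy i f) (dy k (dy i f) z).
  exact/is_derive_dy/smooth_on_dy1.
have d1 i : is_derive z (e_ k) (dy i u) (dy k (dy i u) z).
  exact/is_derive_dy/smooth_on_dy1.
have df : is_derive z (e_ k) f (dy k f z) by exact/is_derive_dy/smooth_on_dy0.
have dv := is_derive_inv (lt0r_neq0 (vol_gt0 Uz)) (is_derive_vol k Uz hc).
have dw := is_derive_sub (is_derive_mul (d0 0) (d1 1)) (is_derive_mul (d0 1) (d1 0)).
exact: is_derive_mul (is_derive_mul df dw) dv.
Qed.

(** The left side is b.d(b.dphi). Differentiated along itself, b becomes the quarter turn of F_ij
    b^i = K n_j, which is a multiple of y; dphi annihilates it, so only phi_ij b^i b^j remains. *)
Lemma factor_bhess_ring (y0 y1 l0 l1 F W B K : R)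
    (u0 u1 u00 u01 u10 u11 f00 f01 f10 f11 : R) : F != 0 ->
  y0 * l0 + y1 * l1 = F ->
  u0 = W * - y1 / F -> u1 = W * y0 / F ->
  u00 = (B * - y1 * - y1 - W * (l0 * - y1 + - y1 * l0)) / F ^+ 2 ->
  u01 = (B * - y1 * y0 - W * (l0 * y0 + - y1 * l1)) / F ^+ 2 ->
  u10 = (B * y0 * - y1 - W * (l1 * - y1 + y0 * l0)) / F ^+ 2 ->
  u11 = (B * y0 * y0 - W * (l1 * y0 + y0 * l1)) / F ^+ 2 ->
  F * f00 = K * - y1 * - y1 -> F * f01 = K * - y1 * y0 ->
  F * f10 = K * y0 * - y1 -> F * f11 = K * y0 * y0 ->
  l0 * (l0 * u11 + u1 * f10 - (l1 * u10 + u0 * f11))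
  - l1 * (l0 * u01 + u1 * f00 - (l1 * u00 + u0 * f01)) = B.
Proof.
move=> F0 hF -> -> -> -> -> -> h00 h01 h10 h11.
have -> : f00 = K * - y1 * - y1 / F by rewrite -h00 mulrC mulKf.
have -> : f01 = K * - y1 * y0 / F by rewrite -h01 mulrC mulKf.
have -> : f10 = K * y0 * - y1 / F by rewrite -h10 mulrC mulKf.
have -> : f11 = K * y0 * y0 / F by rewrite -h11 mulrC mulKf.
by move: F0; rewrite -hF => F0; field.
Qed.

(** This is (F/s) b.d(F W / s), with X_i the derivatives of W. As b annihilates dF, only W and s
    contribute, and the derivative of s carries the term in c. *)
Lemma semi22_ring (y0 y1 l0 l1 F W B e c s X0 X1 : R) : s != 0 ->
  y0 * l0 + y1 * l1 = F -> l0 * X1 - l1 * X0 = B ->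
  F * (l0 * (F * W * (- s ^- 2 * (e * (c * y0 * F ^+ 2) / (2 * s)))
             + s^-1 * (F * X1 + W * l1))
     - l1 * (F * W * (- s ^- 2 * (e * (c * - y1 * F ^+ 2) / (2 * s)))
             + s^-1 * (F * X0 + W * l0))) / s
  = F ^+ 2 * B / s ^+ 2 - e * c * F ^+ 5 * W / (2 * s ^+ 4).
Proof.
move=> s0 hF hB.
transitivity (F ^+ 2 * (l0 * X1 - l1 * X0) / s ^+ 2
  - e * c * F ^+ 4 * W * (y0 * l0 + y1 * l1) / (2 * s ^+ 4)); first by field.
by rewrite hF hB; congr (_ - _ / _); ring.
Qed.

Lemma semi22E z c : U z ->
  (forall k i j, dgmx z k i j = c * ncov z k * ncov z i * ncov z j) ->
  semi2 (sgn_det f) f (semi2 (sgn_det f) f u) z =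
  f z ^+ 2 * bhess z / vol z ^+ 2
  - sgn_det f z * c * f z ^+ 5 * wron z / (2 * vol z ^+ 4).
Proof.
move=> Uz hc; rewrite semi2E //.
rewrite (dy_val (is_derive_semi2 1 Uz hc)) (dy_val (is_derive_semi2 0 Uz hc)).
have [K [_ hK _]] := gmx_form Uz.
apply: semi22_ring (lt0r_neq0 (vol_gt0 Uz)) (metric_euler1 Uz) _.
exact: (factor_bhess_ring (f0 Uz) (metric_euler1 Uz)
  (factor_dyE 0 Uz) (factor_dyE 1 Uz)
  (factor_hessE 0 0 Uz) (factor_hessE 0 1 Uz) (factor_hessE 1 0 Uz)
  (factor_hessE 1 1 Uz) (hK 0 0) (hK 0 1) (hK 1 0) (hK 1 1)).
Qed.

Lemma sigmaE z : U z -> sigma (sgn_det f) f u z =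
  f z ^+ 2 * bhess z / vol z ^+ 2 + 2 * (f z * wron z / vol z) ^+ 2.
Proof.
move=> Uz; have [c hc] := dgmx_form Uz.
rewrite /sigma (semi22E Uz hc) (main_scalarE Uz hc) (phi2E Uz).
have s0 := lt0r_neq0 (vol_gt0 Uz).
have E (F B s e W : R) : s != 0 ->
  F ^+ 2 * B / s ^+ 2 - e * c * F ^+ 5 * W / (2 * s ^+ 4)
  + e * (c * F ^+ 4 / (2 * s ^+ 3)) * (F * W / s) + 2 * (F * W / s) ^+ 2
  = F ^+ 2 * B / s ^+ 2 + 2 * (F * W / s) ^+ 2.
  by move=> {}s0; field.
exact: E.
Qed.

(** * The metric of e^phi F and its determinant *)

Definition fbar z : R := expR (u z) * f z.

Definition fbar1 i z : R :=
  expR (u z) * dy i f z + f z * (expR (u z) * dy i u z).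

(** Left exactly as the product rule delivers it, with i the outer index of differentiation. *)
Definition fbar2 z i j : R :=
  expR (u z) * dy i (dy j f) z + dy j f z * (expR (u z) * dy i u z)
  + (f z * (expR (u z) * dy i (dy j u) z + dy j u z * (expR (u z) * dy i u z))
     + expR (u z) * dy j u z * dy i f z).

Lemma is_derive_exp_factor i z : U z ->
  is_derive z (e_ i) (fun w => expR (u w)) (expR (u z) * dy i u z).
Proof.
move=> Uz; have du : is_derive z (e_ i) u (dy i u z).
  exact/is_derive_dy/smooth_on_dy0.
exact: is_derive_comp_real (is_derive_expR (u z)) du.
Qed.

Lemma is_derive_fbar i z : U z -> is_derive z (e_ i) fbar (fbar1 i z).
Proof.
move=> Uz; have df : is_derive z (e_ i) f (dy i f z).
  exact/is_derive_dy/smooth_on_dy0.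
exact: is_derive_mul (is_derive_exp_factor i Uz) df.
Qed.

Lemma is_derive_fbar1 i j z : U z -> is_derive z (e_ i) (fbar1 j) (fbar2 z i j).
Proof.
move=> Uz; have dE := is_derive_exp_factor i Uz.
have df : is_derive z (e_ i) f (dy i f z) by exact/is_derive_dy/smooth_on_dy0.
have df1 : is_derive z (e_ i) (dy j f) (dy i (dy j f) z).
  exact/is_derive_dy/smooth_on_dy1.
have du1 : is_derive z (e_ i) (dy j u) (dy i (dy j u) z).
  exact/is_derive_dy/smooth_on_dy1.
exact: is_derive_add (is_derive_mul dE df1)
  (is_derive_mul df (is_derive_mul dE du1)).
Qed.

Lemma dy_fbar i z : U z -> dy i fbar z = fbar1 i z.
Proof. by move=> Uz; apply/dy_val/is_derive_fbar. Qed.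

Lemma dy2_fbar i j z : U z -> dy i (dy j fbar) z = fbar2 z i j.
Proof.
move=> Uz; rewrite (dy_near i (h := fbar1 j) Uz); first exact/dy_val/is_derive_fbar1.
by move=> w; exact: dy_fbar.
Qed.

Lemma fbar_euler1 z : U z -> euler1 fbar z.
Proof.
move=> Uz; rewrite /euler1 (dy_fbar 0 Uz) (dy_fbar 1 Uz).
have := factor_euler Uz; rewrite sum_I2.
have E (E F l0 l1 y0 y1 u0 u1 : R) : y0 * l0 + y1 * l1 = F ->
    y0 * u0 + y1 * u1 = 0 ->
    y0 * (E * l0 + F * (E * u0)) + y1 * (E * l1 + F * (E * u1)) = E * F.
  move=> h1 h2; transitivity (E * (y0 * l0 + y1 * l1)
    + F * E * (y0 * u0 + y1 * u1)); first by ring.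
  by rewrite h1 h2 mulr0 addr0.
exact: E (metric_euler1 Uz).
Qed.

Lemma fbar_neq0 z : U z -> fbar z != 0.
Proof. by move=> Uz; rewrite mulf_neq0 ?f0 // lt0r_neq0 // expR_gt0. Qed.

(** The mixed terms of F^2 phi_ij cancel the product-rule terms F (F_i phi_j + F_j phi_i), leaving a
    multiple of n_i n_j; W^2 comes from F^2 phi_i phi_j. *)
Lemma fbar_fbar2 i j z : U z -> fbar z * fbar2 z i j =
  expR (u z) ^+ 2 * (f z * dy i (dy j f) z
    + (bhess z + wron z ^+ 2) * ncov z i * ncov z j).
Proof.
move=> Uz; have E (E F fij li lj ni nj W B ui uj uij : R) : F != 0 ->
  ui = W * ni / F -> uj = W * nj / F ->
  uij = (B * ni * nj - W * (li * nj + ni * lj)) / F ^+ 2 ->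
  E * F * (E * fij + lj * (E * ui) + (F * (E * uij + uj * (E * ui)) + E * uj * li))
  = E ^+ 2 * (F * fij + (B + W ^+ 2) * ni * nj).
  by move=> F0 -> -> ->; field.
exact: E (f0 Uz) (factor_dyE i Uz) (factor_dyE j Uz) (factor_hessE i j Uz).
Qed.

(** The reciprocal of rho, which the hypothesis on sigma makes non-zero. *)
Definition rinv z : R :=
  sigma (sgn_det f) f u z + sgn_det f z - semi2 (sgn_det f) f u z ^+ 2.

Lemma rinvE z : U z -> rinv z =
  f z ^+ 2 * bhess z / vol z ^+ 2 + (f z * wron z / vol z) ^+ 2 + sgn_det f z.
Proof.
move=> Uz; rewrite /rinv sigmaE // phi2E //.
have E (a b c : R) : a + 2 * b + c - b = a + b + c by ring.
exact: E.
Qed.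

(** The K' of the overview, that is, the coefficient K in the frame formulas for e^phi F; with phi =
    0 it reduces to eps s^2 / F^2. *)
Definition Kbar z : R := expR (u z) ^+ 2 * (vol z ^+ 2 / f z ^+ 2) * rinv z.

Lemma gmx_fbar i j z : U z ->
  gmx fbar z i j = dy i fbar z * dy j fbar z + Kbar z * ncov z i * ncov z j.
Proof.
move=> Uz.
rewrite (gmx_of_derive (G := fbar1) (H := fbar2 z) Uz
  (fun w k => is_derive_fbar k (z := w)) (is_derive_fbar1 i j Uz)).
rewrite (dy_fbar i Uz) (dy_fbar j Uz) (fbar_fbar2 i j Uz).
have [K [_ hK gE]] := gmx_form Uz; rewrite (hK i j) /Kbar (rinvE Uz).
(* Both sides equal det g. This turns the contribution K of F F_ij into the summand eps of 1/rho. *)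
have KE : K * f z ^+ 2 = sgn_det f z * vol z ^+ 2.
  by rewrite -det_vol // (det_gmx_frame (metric_euler1 Uz) gE).
have E (a E F s e B W ni nj : R) : F != 0 -> s != 0 -> K * F ^+ 2 = e * s ^+ 2 ->
  a + E ^+ 2 * (K * ni * nj + (B + W ^+ 2) * ni * nj) =
  a + E ^+ 2 * (s ^+ 2 / F ^+ 2) * (F ^+ 2 * B / s ^+ 2 + (F * W / s) ^+ 2 + e)
    * ni * nj.
  move=> F0 s0 h; have -> : e = K * F ^+ 2 / s ^+ 2 by rewrite h mulfK ?expf_neq0.
  by field; apply/andP; split.
exact: E (f0 Uz) (lt0r_neq0 (vol_gt0 Uz)) KE.
Qed.

Lemma Kbar_neq0 z : U z -> rinv z != 0 -> Kbar z != 0.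
Proof.
move=> Uz r0; have s0 := lt0r_neq0 (vol_gt0 Uz).
apply: mulf_neq0 => //; apply: mulf_neq0.
  by rewrite expf_neq0 // lt0r_neq0 // expR_gt0.
by apply: mulf_neq0; rewrite ?invr_eq0 expf_neq0 // f0.
Qed.

Lemma det_fbar z : U z ->
  \det (gmx fbar z) = expR (u z) ^+ 4 * vol z ^+ 2 * rinv z.
Proof.
move=> Uz; rewrite (det_gmx_frame (fbar_euler1 Uz) (fun i j => gmx_fbar i j Uz)).
rewrite /Kbar /fbar; have := f0 Uz.
by move: (expR _) (vol z) (f z) (rinv z) => E s F r F0; field.
Qed.

Lemma sqrt_det_fbar z : U z -> Num.sqrt (sgn_det f z * \det (gmx fbar z)) =
  expR (u z) ^+ 2 * vol z * Num.sqrt (sgn_det f z * rinv z).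
Proof.
move=> Uz; rewrite det_fbar //.
have -> : sgn_det f z * (expR (u z) ^+ 4 * vol z ^+ 2 * rinv z) =
    (expR (u z) ^+ 2 * vol z) ^+ 2 * (sgn_det f z * rinv z) by ring.
rewrite sqrtrM ?sqr_ge0 // sqrtr_sqr ger0_norm // mulr_ge0 ?sqr_ge0 //.
exact: ltW (vol_gt0 Uz).
Qed.

(** If e r < 0 both square roots take the default value 0. Otherwise q = sqrt(e r) satisfies r = e
    q^2, and 1/e = e. *)
Lemma sqrt_sign_quotient (e r : R) : e ^+ 2 = 1 -> r != 0 ->
  Num.sqrt (e * r) / r = e * Num.sqrt (e * r^-1).
Proof.
move=> e2 r0; have e0 : e != 0.
  by apply: contra_eq_neq e2 => ->; rewrite expr0n /= eq_sym oner_eq0.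
have eV : e^-1 = e by apply: (mulfI e0); rewrite divff // -expr2.
have -> : e * r^-1 = (e * r)^-1 by rewrite invfM eV.
have [er|er] := leP 0 (e * r); last first.
  rewrite (ltr0_sqrtr er) ltr0_sqrtr ?invr_lt0 //.
  by rewrite mul0r mulr0.
rewrite sqrtrV //; set q := Num.sqrt _.
have q0 : q != 0 by rewrite sqrtr_eq0 -ltNge lt_def er mulf_neq0.
have rE : r = e * q ^+ 2 by rewrite sqr_sqrtr // mulrA -expr2 e2 mul1r.
by rewrite [in LHS]rE invfM eV; field.
Qed.

Lemma ell_low_fbar i z : U z -> ell_low fbar i z = expR (u z) *
  (ell_low f i z + semi2 (sgn_det f) f u z * m_low (sgn_det f) f i z).
Proof.
move=> Uz; apply: etrans (dy_fbar i Uz) _; rewrite phi2E // m_lowE //.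
have E (E l F s W n ui : R) : F != 0 -> s != 0 -> ui = W * n / F ->
    E * l + F * (E * ui) = E * (l + F * W / s * (s / F * n)).
  by move=> F0 s0 ->; field; apply/andP; split.
exact: E (f0 Uz) (lt0r_neq0 (vol_gt0 Uz)) (factor_dyE i Uz).
Qed.

Lemma hang_fbar i j z : U z -> hang fbar i j z = expR (u z) ^+ 2 *
  (hang f i j z + (sigma (sgn_det f) f u z - semi2 (sgn_det f) f u z ^+ 2)
     * m_low (sgn_det f) f i z * m_low (sgn_det f) f j z).
Proof.
move=> Uz; rewrite /hang (dy2_fbar i j Uz) (fbar_fbar2 i j Uz).
rewrite sigmaE // phi2E // (m_lowE i Uz) (m_lowE j Uz).
have E (E a F s W B ni nj : R) : F != 0 -> s != 0 ->
    E ^+ 2 * (a + (B + W ^+ 2) * ni * nj) =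
    E ^+ 2 * (a + (F ^+ 2 * B / s ^+ 2 + 2 * (F * W / s) ^+ 2
      - (F * W / s) ^+ 2) * (s / F * ni) * (s / F * nj)).
  by move=> F0 s0; field; apply/andP; split.
exact: E (f0 Uz) (lt0r_neq0 (vol_gt0 Uz)).
Qed.

(** The quarter turn taking dF to b takes n to -y, and F dphi = W n. *)
Lemma dvec_fbar i z : U z ->
  dvec fbar z i = expR (u z) * (dvec f z i - wron z * z.2 0 i).
Proof.
move=> Uz; have E1 (E l F W y ui : R) : F != 0 -> ui = W * y / F ->
    E * l + F * (E * ui) = E * (l + W * y).
  by move=> F0 ->; field.
move: i; apply: forall_I2; rewrite /dvec /=.
  rewrite (dy_fbar 1 Uz); apply: etrans (congr1 -%R
    (E1 _ (dy 1 f z) _ _ _ _ (f0 Uz) (factor_dyE 1 Uz))) _.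
  by rewrite -mulrN opprD.
rewrite (dy_fbar 0 Uz); apply: etrans (E1 _ (dy 0 f z) _ _ _ _ (f0 Uz)
  (factor_dyE 0 Uz)) _.
by rewrite /ncov /= mulrN.
Qed.

Lemma ell_upE i z : U z -> ell_up f i z = z.2 0 i / f z.
Proof.
move=> Uz; have [K [K0 _ gE]] := gmx_form Uz.
exact: (ell_up_frame (metric_euler1 Uz) (f0 Uz) gE K0).
Qed.

Lemma m_upE i z : U z ->
  m_up (sgn_det f) f i z = vol z / \det (gmx f z) * dvec f z i.
Proof.
move=> Uz; have [K [K0 _ gE]] := gmx_form Uz.
exact: (m_up_frame (metric_euler1 Uz) (f0 Uz) gE K0).
Qed.

(** * The frame of e^phi F at a point where 1/rho is non-zero *)

Section Frame.
Variable z : TU.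
Hypothesis Uz : U z.
Hypothesis r0 : rinv z != 0.

Let gE i j := gmx_fbar i j Uz.

Lemma ell_up_fbar i : ell_up fbar i z = (expR (u z))^-1 * ell_up f i z.
Proof.
rewrite (ell_up_frame (fbar_euler1 Uz) (fbar_neq0 Uz) gE (Kbar_neq0 Uz r0)).
by rewrite ell_upE // /fbar invfM mulrCA.
Qed.

Lemma m_low_fbar i : m_low (sgn_det f) fbar i z =
  expR (u z) * Num.sqrt (sgn_det f z / rho (sgn_det f) f u z)
    * m_low (sgn_det f) f i z.
Proof.
rewrite (m_low_frame (fbar_euler1 Uz) (fbar_neq0 Uz) gE (Kbar_neq0 Uz r0)).
rewrite sqrt_det_fbar // m_lowE // /rho invrK -/(rinv z) /fbar.
have E (E s q F n : R) : E != 0 -> F != 0 ->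
    E ^+ 2 * s * q / (E * F) * n = E * q * (s / F * n).
  by move=> E0 F0; field; apply/andP; split.
exact: E (lt0r_neq0 (expR_gt0 _)) (f0 Uz).
Qed.

(** The term in y of the new b becomes the one in l^j because y = F l; [sqrt_sign_quotient] turns
    sqrt(eps/rho) divided by 1/rho into eps sqrt(eps rho). *)
Lemma m_up_fbar i : m_up (sgn_det f) fbar i z =
  (expR (u z))^-1 * Num.sqrt (sgn_det f z * rho (sgn_det f) f u z)
  * (m_up (sgn_det f) f i z
     - sgn_det f z * semi2 (sgn_det f) f u z * ell_up f i z).
Proof.
rewrite (m_up_frame (fbar_euler1 Uz) (fbar_neq0 Uz) gE (Kbar_neq0 Uz r0)).
rewrite sqrt_det_fbar // det_fbar // dvec_fbar // m_upE // ell_upE // phi2E //.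
rewrite (det_vol Uz) /rho -/(rinv z).
have := sqrt_sign_quotient (sgn_det_sqr Uz) r0.
have E (E s q r e p d W y F : R) : E != 0 -> s != 0 -> F != 0 -> r != 0 ->
    e != 0 -> e ^+ 2 = 1 -> q / r = e * p ->
    E ^+ 2 * s * q / (E ^+ 4 * s ^+ 2 * r) * (E * (d - W * y)) =
    E^-1 * p * (s / (e * s ^+ 2) * d - e * (F * W / s) * (y / F)).
  move=> E0 s0 F0 r1 e0 e2 h.
  transitivity (E^-1 * (q / r) / s * (d - W * y)).
    by field; apply/and3P; split.
  transitivity (E^-1 * p / s * (d / e - e * W * y)); last first.
    by field; apply/and4P; split.
  have -> : d / e = e * d.
    by apply: (mulfI e0); rewrite mulrCA divff // mulr1 mulrA -expr2 e2 mul1r.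
  by rewrite h; ring.
exact: E (lt0r_neq0 (expR_gt0 _)) (lt0r_neq0 (vol_gt0 Uz)) (f0 Uz) r0
  (sgn_det_neq0 Uz) (sgn_det_sqr Uz).
Qed.

(** The new determinant times eps is a square times eps rho, so the assumption supplies the sign
    condition of [frame_m_pair]. *)
Lemma m_pair_fbar : 0 < sgn_det f z * rho (sgn_det f) f u z ->
  \sum_i m_low (sgn_det f) fbar i z * m_up (sgn_det f) fbar i z = sgn_det f z.
Proof.
move=> er; apply: (frame_m_pair (fbar_euler1 Uz) (fbar_neq0 Uz) gE (Kbar_neq0 Uz r0)).
rewrite det_fbar //.
have -> : sgn_det f z * (expR (u z) ^+ 4 * vol z ^+ 2 * rinv z) =
  (expR (u z) ^+ 2 * vol z * rinv z) ^+ 2 * (sgn_det f z * rho (sgn_det f) f u z).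
  rewrite /rho -/(rinv z); move: r0.
  by move: (expR _) (vol z) (rinv z) (sgn_det f z) => *; field.
by rewrite mulr_ge0 ?sqr_ge0 // ltW.
Qed.

Lemma conformal_frame :
  [/\ (forall i, ell_low fbar i z = expR (u z) * (ell_low f i z
         + semi2 (sgn_det f) f u z * m_low (sgn_det f) f i z)) /\
      (forall i, ell_up fbar i z = (expR (u z))^-1 * ell_up f i z),
      forall i j, hang fbar i j z = expR (u z) ^+ 2 * (hang f i j z
        + (sigma (sgn_det f) f u z - semi2 (sgn_det f) f u z ^+ 2)
          * m_low (sgn_det f) f i z * m_low (sgn_det f) f j z),
      (forall i, m_low (sgn_det f) fbar i z =
         expR (u z) * Num.sqrt (sgn_det f z / rho (sgn_det f) f u z)
         * m_low (sgn_det f) f i z) /\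
      (forall j, m_up (sgn_det f) fbar j z =
         (expR (u z))^-1 * Num.sqrt (sgn_det f z * rho (sgn_det f) f u z)
         * (m_up (sgn_det f) f j z
            - sgn_det f z * semi2 (sgn_det f) f u z * ell_up f j z))
    & [/\ 0 < sgn_det f z * rho (sgn_det f) f u z ->
            \sum_i m_low (sgn_det f) fbar i z * m_up (sgn_det f) fbar i z
            = sgn_det f z,
          \sum_i ell_low fbar i z * ell_up fbar i z = 1,
          \sum_i ell_up fbar i z * m_low (sgn_det f) fbar i z = 0
        & \sum_i ell_low fbar i z * m_up (sgn_det f) fbar i z = 0]].
Proof.
have K0 := Kbar_neq0 Uz r0; have bE := fbar_euler1 Uz; have b0 := fbar_neq0 Uz.
split; [split|by move=> i j; exact: hang_fbar|split|split].
- by move=> i; exact: ell_low_fbar.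
- exact: ell_up_fbar.
- exact: m_low_fbar.
- exact: m_up_fbar.
- exact: m_pair_fbar.
- exact: frame_ell_pair bE b0 gE K0.
- exact: frame_ell_m bE b0 gE K0 _.
- exact: frame_m_ell bE b0 gE K0 _.
Qed.

End Frame.
End Conformal.

End Metric.
End LocalSurface.

(** * Passage from functions on the tangent bundle to their coordinate expressions *)

Section LocalCoordinates.
Variables (R : realType) (M : smoothSurface R) (a : chart M).
Implicit Types (A : set (tangent M)) (t : tangent M) (f g : tangent M -> R).

(** The components in chart [a] determine those in every other chart around the point through the
    Jacobians, and the remaining ones are 0. Hence the value chosen by [xget] in [local_fun] is
    unambiguous. *)
Lemma tcoord_inj t t' : tdom a t -> tdom a t' -> tcoord a t = tcoord a t' ->
  t = t'.
Proof.
move: t t' => [p v v0 vc] [p' v' v0' vc']; rewrite /tdom /tcoord /= => ap ap' [hp hv].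
have {}hp : p = p' by rewrite -(coordK ap) hp coordK.
subst p'; have {}hv : v = v'.
  apply/funext => b; have [bp|bp] := pselect (dom b p); last by rewrite v0 // v0'.
  by rewrite (vc a b ap bp) hv -(vc' a b ap' bp).
by subst v'; congr Tangent; exact: Prop_irrelevance.
Qed.

Lemma local_funE f t : tdom a t -> local_fun a f (tcoord a t) = f t.
Proof.
move=> at_; rewrite /local_fun; case: xgetP => [x _ [t' [at' tt'] <-]|].
  by rewrite (tcoord_inj at' at_ tt').
by move=> /(_ (f t)); case; exists t.
Qed.

Lemma local_fun_out f z : ~ (exists t, tdom a t /\ tcoord a t = z) ->
  local_fun a f z = 0.
Proof.
move=> nz; rewrite /local_fun; case: xgetP => // x _ [t ht _].
by case: nz; exists t.
Qed.

(** The equality is one of functions on the whole coordinate space, so it can be rewritten inside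
    derivatives. *)
Lemma local_fun_conformal f g : local_fun a (fun t => expR (g t) * f t) =
  fun w => expR (local_fun a g w) * local_fun a f w.
Proof.
apply/funext => w.
have [[t [at_ <-]]|nw] := pselect (exists t, tdom a t /\ tcoord a t = w).
  by rewrite !local_funE.
(* Off the image of the chart all local expressions take the default value 0, and the factor coming
   from [f] makes the product 0 as well. *)
by rewrite !local_fun_out // mulr0.
Qed.

Lemma tcoord_tscale c t : tcoord a (tscale c t) = yscale c (tcoord a t).
Proof. by []. Qed.

Lemma local_set_cone A c z : conic_subbundle A -> 0 < c ->
  local_set a A z -> local_set a A (yscale c z).
Proof.
move=> hA c0 [t [At at_] <-]; exists (tscale c t) => //.
by split=> //; exact: conic_scale.
Qed.

Lemma local_fun_homogeneous A k f : conic_subbundle A -> pos_homogeneous A k f ->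
  homogeneous_on (local_set a A) k 0 (local_fun a f).
Proof.
move=> hA hf c _ c0 [t [At at_] <-]; rewrite -tcoord_tscale !local_funE //.
by rewrite expr0 mul1r hf.
Qed.

End LocalCoordinates.

(* The square roots are real ones, and the frame of the new metric is built with
   the sign eps of the old one, so its m-covector is meaningful only where
   eps * rho > 0. Num.sqrt being 0 on negative numbers, the only clause that
   needs this condition is the normalization of the m-covector, and it is the
   only one that assumes it. *)
Theorem proposition3p1 (R : realType) (M : smoothSurface R)
    (A : set (tangent M)) (F phi : tangent M -> R)
    (hF : conic_pseudo_finsler A F)
    (hF0 : forall t, A t -> F t != 0)
    (hphi_smooth : tsmooth A phi)
    (hphi_homogeneous : pos_homogeneous A 0 phi)
    (hsigma : forall (a : chart M) (z : 'rV[R]_2 * 'rV[R]_2),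
       local_set a A z ->
       let f := local_fun a F in
       let u := local_fun a phi in
       let eps := sgn_det f in
       sigma eps f u z + eps z - semi2 eps f u z ^+ 2 != 0)
    (a : chart M) (z : 'rV[R]_2 * 'rV[R]_2) (hz : local_set a A z) :
  let f := local_fun a F in
  let u := local_fun a phi in
  let fbar := local_fun a (fun t => expR (phi t) * F t) in
  let eps := sgn_det f in
  let ephi := expR (u z) in
  let phi2 := semi2 eps f u z in
  let sig := sigma eps f u z in
  let rh := rho eps f u z in
  let m i := m_low eps f i z in
  let mbar i := m_low eps fbar i z in
  let mbar_up i := m_up eps fbar i z in
  [/\ (* (i) *)
      (forall i, ell_low fbar i z = ephi * (ell_low f i z + phi2 * m i)) /\
      (forall i, ell_up fbar i z = ephi^-1 * ell_up f i z),
      (* (ii) *)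
      forall i j, hang fbar i j z =
        ephi ^+ 2 * (hang f i j z + (sig - phi2 ^+ 2) * m i * m j),
      (* (iii) *)
      (forall i, mbar i = ephi * Num.sqrt (eps z / rh) * m i) /\
      (forall j, mbar_up j = ephi^-1 * Num.sqrt (eps z * rh) *
        (m_up eps f j z - eps z * phi2 * ell_up f j z))
    & (* (iv) *)
      [/\ 0 < eps z * rh -> \sum_i mbar i * mbar_up i = eps z,
          \sum_i ell_low fbar i z * ell_up fbar i z = 1,
          \sum_i ell_up fbar i z * mbar i = 0
        & \sum_i ell_low fbar i z * mbar_up i = 0]].

Proof.
move=> f u fbar0 eps ephi phi2 sig rh m mbar mbar_up.
have hA := cpf_conic hF.
have fbarE : fbar0 = fbar f u by exact: local_fun_conformal.
rewrite /mbar /mbar_up fbarE.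
have r0 : rinv f u z != 0 by exact: hsigma hz.
apply: (conformal_frame (U := local_set a A)) => //.
- exact: (conic_open hA).
- by move=> c w c0; exact: local_set_cone.
- exact: (cpf_smooth hF).
- exact: local_fun_homogeneous (cpf_homogeneous hF).
- by move=> _ [t [At at_] <-]; rewrite /f local_funE // hF0.
- by move=> w Uw; exact: cpf_nondegenerate hF _ _ Uw.
- exact: local_fun_homogeneous hphi_homogeneous.
Qed.
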